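(* Let $H$ be a hypergraph having at least two distinct edges with nonempty intersection, let $M$ be its line graph, let $\alpha\in\mathbb R_{\ge0}^{E(M)}$, and let $p$ be an intersection capacity allocation on $H$. Then \[ \gamma_H^{\mathsf{Sub}}(q_{M,\alpha})\le \kappa(p)\max_{e\in E(H)}\alpha(\mathrm{Inc}_M(e)). \] In particular, $\mathfrak R(H)\le\kappa(H)$.
   Context: Hypergraphs $H=(V,E)$ are finite, with $E\subseteq 2^V$, and have no isolated vertices. For a set of sets $X$, $\bigcup X$ is the union of its members ($\bigcup\emptyset=\emptyset$). The line graph $M=P(H^* )$ has vertex set $E(H)$, with distinct $e,f$ adjacent iff $e\cap f\ne\emptyset$. For $\alpha:E(M)\to\mathbb R_{\ge0}$ and $F\subseteq E(H)$, $q_{M,\alpha}(F):=\sum\{\alpha_{xy}: xy\in E(M), x\in F, y\notin F\}$; $\alpha(\mathrm{Inc}_M(e))$ is the sum of $\alpha$ over the edges of $M$ incident with $e$. $\mathbf 1\text{-}\mathsf{Sub}(H)$ is the set of functions $b:2^V\to\mathbb R_{\ge0}$ that are normalised ($b(\emptyset)=0$), monotone, submodular, and satisfy $b(X)\le 1$ for all $e\in E$, $X\subseteq e$. For $F\subseteq E$, $\partial_H(F):=(\bigcup F)\cap(\bigcup(E\setminus F))$ and $\lambda_b(F):=b(\partial_H(F))$. $K^{\mathsf{Sub}}_{\mathbf 1}(H):=\{q\in\mathbb R_{\ge0}^{2^E}: \exists b\in\mathbf 1\text{-}\mathsf{Sub}(H)\text{ with } q\le\lambda_b\text{ pointwise}\}$,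 and $\gamma_H^{\mathsf{Sub}}(q):=\inf\{c\ge0: q\in c\cdot K^{\mathsf{Sub}}_{\mathbf 1}(H)\}$ ($+\infty$ if no such $c$). The submodular gauge-routing ratio is $\mathfrak R(H):=\sup_{\alpha\ne0}\gamma_H^{\mathsf{Sub}}(q_{M,\alpha})/\max_{e\in E(H)}\alpha(\mathrm{Inc}_M(e))$ over nonzero $\alpha:E(M)\to\mathbb R_{\ge0}$. An intersection capacity allocation on $H$ is a family $p=(p_{xy,v})$ of nonnegative reals, indexed by $xy\in E(M)$ and $v\in x\cap y$, with $\sum_{v\in x\cap y}p_{xy,v}=1$ for every $xy\in E(M)$. For $e\in E(H)$ put $w_e^p(xy):=\sum_{v\in e\cap x\cap y}p_{xy,v}$, \[ \kappa_e(p):=\max\Bigl\{\sum_{xy\in E(M)}w_e^p(xy)\beta_{xy} : \beta\in\mathbb R_{\ge0}^{E(M)},\ \beta(\mathrm{Inc}_M(h))\le1\ \forall h\in E(H)\Bigr\}, \] $\kappa(p):=\max_{e\in E(H)}\kappa_e(p)$, and $\kappa(H):=\min_p\kappa(p)$ over all intersection capacity allocations $p$ on $H$. *)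

(* Defs.v *)
From HB Require Import structures.
From mathcomp Require Import all_boot all_order all_algebra.
From mathcomp Require Import all_classical all_reals ereal.
Set Implicit Arguments.
Unset Strict Implicit.
Unset Printing Implicit Defensive.
Import Order.TTheory GRing.Theory Num.Theory.
Local Open Scope ring_scope.

(* The empty set is allowed as an edge; a vertex is isolated when it lies in
   no edge. *)
Record hypergraph (V : finType) := Hypergraph {
  edges : {set {set V}};
  no_isolated : forall v : V, exists2 e, e \in edges & v \in e
}.

Definition line_adj (V : finType) (H : hypergraph V) (e f : {set V}) : bool :=
  [&& e \in edges H, f \in edges H, e != f & e :&: f != finset.set0].

(* An edge xy of the line graph is the two-element set [set x; y], so that
   each unordered pair is counted once in sums. *)
Definition line_edges (V : finType) (H : hypergraph V) : {set {set {set V}}} :=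
  [set P | [exists x, exists y, line_adj H x y && (P == [set x; y]%SET)]]%SET.

(* For P = {x, y} this is the intersection of x and y. *)
Definition common (V : finType) (P : {set {set V}}) : {set V} :=
  (\bigcap_(x in P) x)%SET.

(* Weights on line-graph edges are total functions; only their values on
   line_edges H are ever constrained or used. *)
Definition weight (R : realType) (V : finType) : Type := {set {set V}} -> R.

Definition nonneg_weight (R : realType) (V : finType) (H : hypergraph V)
    (alpha : weight R V) : Prop :=
  forall P, P \in line_edges H -> 0 <= alpha P.

Definition incident_weight (R : realType) (V : finType) (H : hypergraph V)
    (alpha : weight R V) (e : {set V}) : R :=
  \sum_(P in line_edges H | e \in P) alpha P.

(* The default value 0 of the maximum is harmless: the values are nonnegative
   when alpha is. *)
Definition max_incident_weight (R : realType) (V : finType) (H : hypergraph V)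
    (alpha : weight R V) : R :=
  \big[Num.max/0]_(e in edges H) incident_weight H alpha e.

Definition cut_weight (R : realType) (V : finType) (H : hypergraph V)
    (alpha : weight R V) (F : {set {set V}}) : R :=
  \sum_(P in line_edges H |
        [exists x in P, exists y in P, (x \in F) && (y \notin F)]) alpha P.

Definition one_sub (R : realType) (V : finType) (H : hypergraph V)
    (b : {set V} -> R) : Prop :=
  [/\ forall X, 0 <= b X,
      b finset.set0 = 0,
      forall X Y : {set V}, X \subset Y -> b X <= b Y,
      forall X Y : {set V}, b (X :|: Y) + b (X :&: Y) <= b X + b Y &
      forall e X : {set V}, e \in edges H -> X \subset e -> b X <= 1].

Definition boundary (V : finType) (H : hypergraph V) (F : {set {set V}}) :
    {set V} :=
  finset.cover F :&: finset.cover (edges H :\: F).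

Definition lambda (R : realType) (V : finType) (H : hypergraph V)
    (b : {set V} -> R) (F : {set {set V}}) : R :=
  b (boundary H F).

(* Functions on the power set of E(H) are represented by total functions on
   {set {set V}}, of which only the values at F \subset edges H matter. *)
Definition K_sub (R : realType) (V : finType) (H : hypergraph V)
    (q : {set {set V}} -> R) : Prop :=
  (forall F : {set {set V}}, F \subset edges H -> 0 <= q F) /\
  exists2 b : {set V} -> R, one_sub H b &
    forall F : {set {set V}}, F \subset edges H -> q F <= lambda H b F.

Definition scaled_K_sub (R : realType) (V : finType) (H : hypergraph V)
    (c : R) (q : {set {set V}} -> R) : Prop :=
  exists2 k : {set {set V}} -> R, K_sub H k &
    forall F : {set {set V}}, F \subset edges H -> q F = c * k F.

Definition gauge_sub (R : realType) (V : finType) (H : hypergraph V)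
    (q : {set {set V}} -> R) : \bar R :=
  ereal_inf [set c%:E | c in [set c : R | 0 <= c /\ scaled_K_sub H c q]]%classic.

Definition gauge_routing_ratio (R : realType) (V : finType)
    (H : hypergraph V) : \bar R :=
  ereal_sup
    [set (gauge_sub H (cut_weight H alpha)
            / (max_incident_weight H alpha)%:E)%E
      | alpha in [set alpha : weight R V | nonneg_weight H alpha /\
          exists2 P, P \in line_edges H & alpha P != 0]]%classic.

Definition allocation (R : realType) (V : finType) (H : hypergraph V)
    (p : {set {set V}} -> V -> R) : Prop :=
  forall P, P \in line_edges H ->
    (forall v, v \in common P -> 0 <= p P v) /\
    \sum_(v in common P) p P v = 1.

Definition alloc_weight (R : realType) (V : finType)
    (p : {set {set V}} -> V -> R) (e : {set V}) : weight R V :=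
  fun P => \sum_(v in e :&: common P) p P v.

Definition kappa_values (R : realType) (V : finType) (H : hypergraph V)
    (p : {set {set V}} -> V -> R) (e : {set V}) : set R :=
  [set \sum_(P in line_edges H) alloc_weight p e P * beta P
    | beta in [set beta : weight R V | nonneg_weight H beta /\
        forall h, h \in edges H -> incident_weight H beta h <= 1]]%classic.

(* The maximum of a linear form over a nonempty compact polytope, hence equal
   to this supremum. *)
Definition kappa_edge (R : realType) (V : finType) (H : hypergraph V)
    (p : {set {set V}} -> V -> R) (e : {set V}) : R :=
  sup (kappa_values H p e).

Definition kappa_alloc (R : realType) (V : finType) (H : hypergraph V)
    (p : {set {set V}} -> V -> R) : R :=
  \big[Num.max/0]_(e in edges H) kappa_edge H p e.

(* The minimum over the nonempty compact set of allocations of a continuous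
   function, hence equal to this infimum. *)
Definition kappa (R : realType) (V : finType) (H : hypergraph V) : R :=
  inf [set kappa_alloc H p | p in [set p | @allocation R V H p]]%classic.

(* The real-valued sup in kappa_edge and inf in kappa range over nonempty sets
   bounded on the relevant side, so their default value does not occur. *)

Lemma kappa_values_has_sup (R : realType) (V : finType) (H : hypergraph V)
    (p : {set {set V}} -> V -> R) (e : {set V}) :
  allocation H p -> has_sup (kappa_values H p e).
Proof.
move=> Hp; have w0 P : P \in line_edges H -> 0 <= alloc_weight p e P.
  move=> /Hp[p0 _]; apply: sumr_ge0 => v; rewrite inE => /andP[_]; exact: p0.
split.
  exists 0, (fun=> 0); last by rewrite big1 // => P _; rewrite mulr0.
  split => // h _; rewrite /incident_weight big1 //; exact: ler01.
exists (\sum_(P in line_edges H) alloc_weight p e P) => _ [beta [b0 b1] <-].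
apply: ler_sum => P PM; rewrite -[leRHS]mulr1 ler_wpM2l ?w0 //.
have := PM; rewrite inE => /existsP[x /existsP[y /andP[/and4P[xE _ _ _] /eqP PE]]].
apply: le_trans (b1 x xE); rewrite /incident_weight (bigD1 P) /=; last first.
  by rewrite PM PE !inE eqxx.
by rewrite lerDl; apply: sumr_ge0 => Q /andP[/andP[QM _] _]; apply: b0.
Qed.

Lemma kappa_has_inf (R : realType) (V : finType) (H : hypergraph V) :
  has_inf [set kappa_alloc H p | p in [set p | @allocation R V H p]]%classic.
Proof.
split; last first.
  exists 0 => _ [p _ <-]; rewrite /kappa_alloc.
  by elim/big_rec: _ => // e x _ x0; rewrite le_max x0 orbT.
exists (kappa_alloc H (fun P _ => (#|common P|%:R)^-1)), (fun P _ => (#|common P|%:R)^-1) => //.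
move=> P; rewrite inE => /existsP[x /existsP[y /andP[/and4P[_ _ _ xy] /eqP ->]]].
split=> [v _|]; first by rewrite invr_ge0.
rewrite sumr_const -[X in X *+ _]mul1r -mulrnAr -mulr_natl mul1r mulfV //.
rewrite pnatr_eq0 -lt0n card_gt0; have /set0Pn[v] := xy.
rewrite inE => /andP[vx vy]; apply/set0Pn; exists v; apply/bigcapP => z.
by rewrite !inE => /orP[] /eqP ->.
Qed.

(* Main.v *)
Require Import Defs.
From HB Require Import structures.
From mathcomp Require Import all_boot all_order all_algebra.
From mathcomp Require Import all_classical all_reals ereal.
Set Implicit Arguments.
Unset Strict Implicit.
Unset Printing Implicit Defensive.
Import Order.TTheory GRing.Theory Num.Theory.
Local Open Scope ring_scope.

(* Spreading each weight alpha_P over the vertices of the intersection P according to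
   p gives a modular function b.  A line-graph edge cut by F has its whole intersection
   in the boundary of F, so b dominates the cut weight there; and b(e) is the value
   at alpha of the linear form defining kappa_e(p), so b(e) <= kappa(p) max alpha(Inc)
   by homogeneity.  Dividing b by this bound gives a member of 1-Sub(H). *)

Section Allocation.
Variables (R : realType) (V : finType) (H : hypergraph V).

(** The sum runs over line-graph edges rather than vertices, so that the value at an edge [e] is
    literally the linear form of [kappa_values] evaluated at [alpha]. *)
Definition spread (alpha : weight R V) (p : {set {set V}} -> V -> R)
    (X : {set V}) : R :=
  \sum_(P in line_edges H) alloc_weight p X P * alpha P.

Lemma line_edges_ex (P : {set {set V}}) : P \in line_edges H ->
  exists2 x, x \in edges H & x \in P.
Proof.
rewrite inE => /existsP[x /existsP[y /andP[/and4P[xE _ _ _] /eqP ->]]].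
by exists x; rewrite // !inE eqxx.
Qed.

Lemma line_edges_sub (P : {set {set V}}) : P \in line_edges H ->
  P \subset edges H.
Proof.
rewrite inE => /existsP[x /existsP[y /andP[/and4P[xE yE _ _] /eqP ->]]].
by apply/fintype.subsetP => z; rewrite !inE => /orP[] /eqP ->.
Qed.

Lemma common_sub (P : {set {set V}}) (x : {set V}) : x \in P ->
  common P \subset x.
Proof. by move=> xP; rewrite /common (bigD1 x) /= ?finset.subsetIl. Qed.

Lemma le_max_incident_weight (alpha : weight R V) (e : {set V}) :
  e \in edges H -> incident_weight H alpha e <= max_incident_weight H alpha.
Proof. by move=> eE; rewrite /max_incident_weight (bigD1 e) //= le_max lexx. Qed.

Lemma max_incident_weight_ge0 (alpha : weight R V) :
  0 <= max_incident_weight H alpha.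
Proof.
by rewrite /max_incident_weight; elim/big_rec: _ => // e x _ x0; rewrite le_max x0 orbT.
Qed.

Lemma kappa_edge_le (p : {set {set V}} -> V -> R) (e : {set V}) :
  e \in edges H -> kappa_edge H p e <= kappa_alloc H p.
Proof. by move=> eE; rewrite /kappa_alloc (bigD1 e) //= le_max lexx. Qed.

Lemma kappa_alloc_ge0 (p : {set {set V}} -> V -> R) : 0 <= kappa_alloc H p.
Proof.
by rewrite /kappa_alloc; elim/big_rec: _ => // e x _ x0; rewrite le_max x0 orbT.
Qed.

Variables (alpha : weight R V) (alpha_ge0 : nonneg_weight H alpha).

Lemma le_incident_weight (P : {set {set V}}) (x : {set V}) :
  P \in line_edges H -> x \in P -> alpha P <= incident_weight H alpha x.
Proof.
move=> PM xP; rewrite /incident_weight (bigD1 P) /=; last by rewrite PM.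
by rewrite lerDl; apply: sumr_ge0 => Q /andP[/andP[QM _] _]; apply: alpha_ge0.
Qed.

(** Makes [alpha] vanish on the line graph when the maximum is 0, and the maximum positive when some
    weight is nonzero. *)
Lemma weight_le_max (P : {set {set V}}) : P \in line_edges H ->
  alpha P <= max_incident_weight H alpha.
Proof.
move=> PM; have [x xE xP] := line_edges_ex PM.
exact: le_trans (le_incident_weight PM xP) (le_max_incident_weight _ xE).
Qed.

Variables (p : {set {set V}} -> V -> R) (p_alloc : allocation H p).

Lemma alloc_weight_ge0 (P : {set {set V}}) (X : {set V}) :
  P \in line_edges H -> 0 <= alloc_weight p X P.
Proof.
move=> /p_alloc[p0 _]; apply: sumr_ge0 => v; rewrite inE => /andP[_]; exact: p0.
Qed.

Lemma alloc_weight_le (P : {set {set V}}) (X Y : {set V}) :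
  P \in line_edges H -> X \subset Y -> alloc_weight p X P <= alloc_weight p Y P.
Proof.
move=> /p_alloc[p0 _] XY; rewrite /alloc_weight.
rewrite [leRHS](big_setID (X :&: common P)) /=.
rewrite (finset.setIidPr (finset.setSI _ XY)) lerDl; apply: sumr_ge0 => v.
by rewrite !inE => /andP[_ /andP[_]]; apply: p0.
Qed.

Lemma alloc_weight1 (P : {set {set V}}) (X : {set V}) :
  P \in line_edges H -> common P \subset X -> alloc_weight p X P = 1.
Proof.
by move=> /p_alloc[_ p1] PX; rewrite /alloc_weight (finset.setIidPr PX).
Qed.

Lemma alloc_weightUI (P : {set {set V}}) (X Y : {set V}) :
  alloc_weight p (X :|: Y)%SET P + alloc_weight p (X :&: Y)%SET P
  = alloc_weight p X P + alloc_weight p Y P.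
Proof.
(* Once membership in [Z] is a 0/1 coefficient, all four sums run over [common P], and modularity is
   an identity of indicators at each vertex. *)
have E (Z : {set V}) :
    alloc_weight p Z P = \sum_(v in common P) (v \in Z)%:R * p P v.
  rewrite /alloc_weight [RHS](bigID (fun v => v \in Z)) /= [X in _ + X]big1 ?addr0.
    apply: eq_big => v; first by rewrite inE andbC.
    by rewrite inE => /andP[-> _]; rewrite mul1r.
  by move=> v /andP[_ /negbTE ->]; rewrite mul0r.
rewrite !E -!big_split; apply: eq_bigr => v _ /=; rewrite !inE -!mulrDl.
by case: (v \in X); case: (v \in Y); rewrite /= ?addr0 ?add0r.
Qed.

Lemma spread_ge0 (X : {set V}) : 0 <= spread alpha p X.
Proof.
by apply: sumr_ge0 => P PM; rewrite mulr_ge0 ?alloc_weight_ge0 ?alpha_ge0.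
Qed.

Lemma spread0 : spread alpha p finset.set0 = 0.
Proof.
by apply: big1 => P _; rewrite /alloc_weight finset.set0I big_set0 mul0r.
Qed.

Lemma spread_le (X Y : {set V}) : X \subset Y ->
  spread alpha p X <= spread alpha p Y.
Proof.
by move=> XY; apply: ler_sum => P PM; rewrite ler_wpM2r ?alpha_ge0 ?alloc_weight_le.
Qed.

Lemma spreadUI (X Y : {set V}) :
  spread alpha p (X :|: Y)%SET + spread alpha p (X :&: Y)%SET
  = spread alpha p X + spread alpha p Y.
Proof.
rewrite /spread -!big_split; apply: eq_bigr => P _ /=.
by rewrite -!mulrDl alloc_weightUI.
Qed.

Lemma spread_edge_le (e : {set V}) : e \in edges H ->
  spread alpha p e <= kappa_alloc H p * max_incident_weight H alpha.
Proof.
move=> eE; set A := max_incident_weight H alpha.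
(* For [A = 0] no rescaling is possible, but every weight is then squeezed to 0. *)
have [A0|A0] := eqVneq A 0.
  rewrite A0 mulr0 /spread big1 // => P PM; suff -> : alpha P = 0 by rewrite mulr0.
  by apply/eqP; rewrite eq_le alpha_ge0 // -[leRHS]A0 weight_le_max.
have {}A0 : 0 < A by rewrite lt_neqAle eq_sym A0 max_incident_weight_ge0.
rewrite -ler_pdivrMr //; apply: le_trans (kappa_edge_le p eE).
apply: ub_le_sup; first by have [] := kappa_values_has_sup e p_alloc.
(* Divided by its largest incident weight, [alpha] satisfies all constraints on [beta] and so
   competes in the supremum. *)
exists (fun P => alpha P / A); last first.
  by rewrite /spread mulr_suml; apply: eq_bigr => P _; rewrite mulrA.
split=> [P PM|h hE]; first by rewrite divr_ge0 ?alpha_ge0 ?ltW.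
rewrite /incident_weight -mulr_suml ler_pdivrMr // mul1r.
exact: le_max_incident_weight.
Qed.

(** Any edge [x] in [P] contains [common P], so [alpha P] enters the spread of [x] with coefficient
    1. This handles a scaling factor equal to 0. *)
Lemma weight_le_kappa (P : {set {set V}}) : P \in line_edges H ->
  alpha P <= kappa_alloc H p * max_incident_weight H alpha.
Proof.
move=> PM; have [x xE xP] := line_edges_ex PM.
apply: le_trans (spread_edge_le xE).
rewrite /spread (bigD1 P) //= alloc_weight1 ?common_sub // mul1r lerDl.
apply: sumr_ge0 => Q /andP[QM _].
by rewrite mulr_ge0 ?alloc_weight_ge0 ?alpha_ge0.
Qed.

Lemma cut_weight_ge0 (F : {set {set V}}) : 0 <= cut_weight H alpha F.
Proof. by apply: sumr_ge0 => P /andP[PM _]; apply: alpha_ge0. Qed.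

Lemma cut_weight_le_spread (F : {set {set V}}) :
  cut_weight H alpha F <= spread alpha p (boundary H F).
Proof.
(* The comparison is termwise over all line-graph edges: an uncut edge counts 0 on the left, a cut
   one has coefficient 1 on the right. *)
rewrite /cut_weight big_mkcondr; apply: ler_sum => P PM.
case: ifP => [|_]; last by rewrite mulr_ge0 ?alloc_weight_ge0 ?alpha_ge0.
move=> /existsP[x /andP[xP /existsP[y /andP[yP /andP[xF yF]]]]].
rewrite alloc_weight1 ?mul1r // finset.subsetI.
rewrite (fintype.subset_trans (common_sub xP)) ?finset.bigcup_sup //=.
rewrite (fintype.subset_trans (common_sub yP)) ?finset.bigcup_sup // inE yF.
exact: (fintype.subsetP (line_edges_sub PM)).
Qed.

Lemma scaled_K_sub_cut_weight :
  scaled_K_sub H (kappa_alloc H p * max_incident_weight H alpha)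
    (cut_weight H alpha).
Proof.
set c := kappa_alloc H p * _.
have c0 : 0 <= c by rewrite mulr_ge0 ?kappa_alloc_ge0 ?max_incident_weight_ge0.
(* Since [0^-1 = 0], the witnesses below also cover [c = 0]: both are then zero, and so is the cut
   weight, by [weight_le_kappa]. *)
have ci0 : 0 <= c^-1 by rewrite invr_ge0.
exists (fun F => c^-1 * cut_weight H alpha F); last first.
  move=> F _; have [c00|cn0] := eqVneq c 0; last by rewrite mulVKf.
  rewrite c00 mul0r /cut_weight big1 // => P /andP[PM _].
  by apply/eqP; rewrite eq_le alpha_ge0 // -[leRHS]c00 weight_le_kappa.
split=> [F _|]; first by rewrite mulr_ge0 ?cut_weight_ge0.
exists (fun X => c^-1 * spread alpha p X); last first.
  by move=> F _; rewrite ler_wpM2l ?cut_weight_le_spread.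
split=> [X||X Y XY|X Y|e X eE Xe].
- by rewrite mulr_ge0 ?spread_ge0.
- by rewrite spread0 mulr0.
- by rewrite ler_wpM2l ?spread_le.
- by rewrite -!mulrDr spreadUI.
have [->|cn0] := eqVneq c 0; first by rewrite invr0 mul0r.
rewrite mulrC ler_pdivrMr ?mul1r; last by rewrite lt_neqAle eq_sym cn0.
exact: le_trans (spread_le Xe) (spread_edge_le eE).
Qed.

Lemma gauge_sub_cut_weight_le :
  (gauge_sub H (cut_weight H alpha)
     <= (kappa_alloc H p * max_incident_weight H alpha)%:E)%E.
Proof.
apply: ereal_inf_lbound; exists (kappa_alloc H p * max_incident_weight H alpha) => //.
split; last exact: scaled_K_sub_cut_weight.
by rewrite mulr_ge0 ?kappa_alloc_ge0 ?max_incident_weight_ge0.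
Qed.

End Allocation.

Theorem lemma6p8 (R : realType) (V : finType) (H : hypergraph V)
    (hH : exists e f : {set V}, line_adj H e f) :
  (forall (alpha : weight R V) (p : {set {set V}} -> V -> R),
     nonneg_weight H alpha -> allocation H p ->
     (gauge_sub H (cut_weight H alpha)
        <= (kappa_alloc H p * max_incident_weight H alpha)%:E)%E) /\
  (gauge_routing_ratio R H <= (kappa R H)%:E)%E.
Proof.
split=> [alpha p alpha0 p_alloc|]; first exact: gauge_sub_cut_weight_le.
apply: ge_ereal_sup => _ [alpha [alpha0 [P PM aP]] <-].
have A0 : 0 < max_incident_weight H alpha.
  by apply: lt_le_trans (weight_le_max alpha0 PM); rewrite lt_neqAle eq_sym aP alpha0.
(* An allocation within [eps] of the infimum takes the place of a minimiser. *)
apply/lee_addgt0Pr => eps eps0.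
have [_ [p p_alloc <-] plt] := inf_adherent eps0 (kappa_has_inf R H).
rewrite -EFinD; apply: le_trans (_ : _ <= (kappa_alloc H p)%:E)%E _; last first.
  by rewrite lee_fin ltW.
(* Positivity of the maximum makes the extended-real quotient an ordinary division, which reduces
   the goal to the first claim. *)
by rewrite inver gt_eqF // lee_pdivrMr // -EFinM; exact: gauge_sub_cut_weight_le.
Qed.
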